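(* Let $A$ be a finite set of real numbers, let $k\ge 1$ be an integer and let $f:\mathbb{R}\to\mathbb{R}$ be a $k$-convex function. If $k=2s$ is even, then \[ |2^k f((s+1)A-sA) - (2^k-1) f((s+1)A-sA)| \gg_k |A|^{k+1}, \] and if $k=2s-1$ is odd, then \[ |2^k f(sA-sA) - (2^k-1) f(sA-sA)| \gg_k |A|^{k+1}. \]
   Context: A function $f:\mathbb{R}\to\mathbb{R}$ of class $C^k$ is called $k$-convex if each of $f^{(0)}=f, f^{(1)},\dots,f^{(k)}$ is strictly monotone (each either strictly increasing or strictly decreasing). For a set $X\subseteq\mathbb{R}$ and nonnegative integers $m,n$, $mX-nX$ denotes $\{x_1+\dots+x_m-y_1-\dots-y_n: x_i,y_j\in X\}$, and $f(X)=\{f(x):x\in X\}$. The notation $X\gg_k Y$ means $X\ge c(k)Y$ for a constant $c(k)>0$ depending only on $k$. *)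

(* Defs.v *)
From mathcomp Require Export all_boot all_order all_algebra finmap.
From mathcomp Require Export all_classical all_reals all_analysis.
Set Implicit Arguments.
Unset Strict Implicit.
Unset Printing Implicit Defensive.
Export Order.TTheory GRing.Theory Num.Theory.
Export numFieldNormedType.Exports.

Local Open Scope ring_scope.
Local Open Scope fset_scope.

Definition classC (R : realType) (k : nat) (f : R -> R) : Prop :=
  (forall i x, (i < k)%N -> derivable (derive1n i f) x 1) /\
  continuous (derive1n k f).

Definition strictly_monotone (R : realType) (g : R -> R) : Prop :=
  {homo g : x y / x < y} \/ {homo g : x y /~ x < y}.

Definition kconvex (R : realType) (k : nat) (f : R -> R) : Prop :=
  classC k f /\ forall i, (i <= k)%N -> strictly_monotone (derive1n i f).

(* X, used as a type, is the finite type of elements of X, so x and y range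
   over all m-tuples and n-tuples of (not necessarily distinct) elements of
   X. *)
Definition sumdiff (R : realType) (m n : nat) (X : {fset R}) : {fset R} :=
  [fset \sum_(i < m) val (x i) - \sum_(j < n) val (y j)
    | x : {ffun 'I_m -> X} in {: {ffun 'I_m -> X}},
      y : {ffun 'I_n -> X} in {: {ffun 'I_n -> X}}].

(* Main.v *)
(** If d > 0 is the smallest gap a'' - a' of A and u + v = k, then
    (u+1)A - vA contains t + A + {0, d, ..., kd} with t = u a' - v a''. On
    this set one squeezes by induction on k: for increasing f and consecutive
    elements x < y of A, adding to f(x) positive elements u <= f(x+d) - f(x)
    keeps the sum in (f(x), f(y)], and such u are supplied by the induction
    hypothesis for the (k-1)-convex function x |-> f(x+d) - f(x) on the part
    of A where that function is at most its value at x. Summing over x gives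
    binomial(|A|, k+1) distinct elements. *)
Require Import Defs.
From mathcomp Require Import all_boot all_order all_algebra finmap.
From mathcomp Require Import all_classical all_reals all_analysis.
From mathcomp Require Import zify ring lra.
Local Open Scope ring_scope.

(** * Finite differences in place of derivatives *)

Definition fdiff {R : realType} (d : R) (f : R -> R) (x : R) : R :=
  f (x + d) - f x.

(** The recursion matches the induction in [squeeze], which passes from [f] to [fdiff d f]. Every
    positive step is allowed because the step used later depends on [A]. *)
Fixpoint discrete_kconvex {R : realType} (k : nat) (f : R -> R) : Prop :=
  strictly_monotone f /\
  if k is j.+1 then forall d, 0 < d -> discrete_kconvex j (fdiff d f) else True.

Lemma strictly_monotoneN {R : realType} (f : R -> R) :
  strictly_monotone f -> strictly_monotone (fun x => - f x).
Proof. by case=> fm; [right | left] => x y /fm; rewrite ltrN2. Qed.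

Lemma fdiffN {R : realType} (d : R) (f : R -> R) :
  fdiff d (fun x => - f x) = (fun x => - fdiff d f x).
Proof. by apply/funext => x; rewrite /fdiff opprB opprK addrC. Qed.

Lemma discrete_kconvexN {R : realType} (k : nat) (f : R -> R) :
  discrete_kconvex k f -> discrete_kconvex k (fun x => - f x).
Proof.
elim: k f => [|k IH] f [fm fd]; split=> //; try exact: strictly_monotoneN.
by move=> d d0; rewrite fdiffN; exact/IH/fd.
Qed.

Lemma discrete_kconvex_monotone {R : realType} (k : nat) (f : R -> R) :
  discrete_kconvex k f -> strictly_monotone f.
Proof. by case: k => [|k] []. Qed.

Lemma is_derive_fdiff {R : realType} (d : R) (g : R -> R) (x : R) :
  (forall y, derivable g y 1) -> is_derive x 1 (fdiff d g) (fdiff d g^`()%classic x).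
Proof.
move=> dg.
have dgd (y : R) : is_derive y 1 g (g^`()%classic y).
  by rewrite derive1E; exact: derivableP.
have dsh : is_derive x 1 (fun y : R => g (y + d)) (g^`()%classic (x + d)).
  rewrite -[g^`()%classic (x + d)]mulr1.
  by apply: (@is_derive1_comp _ g (fun y => y + d)); apply: is_derive_eq; rewrite addr0.
exact: is_deriveB.
Qed.

(** By the mean value theorem, increments of [fdiff d g] over [x < y] have the sign of [fdiff d] of
    the derivative of [g], and this sign is constant. *)
Lemma fdiff_monotone {R : realType} (d : R) (g : R -> R) : 0 < d ->
  (forall y, derivable g y 1) -> strictly_monotone g^`()%classic ->
  strictly_monotone (fdiff d g).
Proof.
move=> d0 dg g'm.
have mvt (x y : R) : x < y -> exists c,
    fdiff d g y - fdiff d g x = fdiff d g^`()%classic c * (y - x).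
  move=> xy; have [||c _ ->] := @MVT R (fdiff d g) (fdiff d g^`()%classic) x y xy.
  - by move=> z _; exact: is_derive_fdiff.
  - apply: continuous_subspaceT => z; apply: differentiable_continuous.
    by apply/derivable1_diffP; have := is_derive_fdiff d g z dg; case.
  - by exists c.
case: g'm => g'm; [left | right].
  move=> x y xy; have [c cE] := mvt _ _ xy.
  by rewrite -subr_gt0 cE mulr_gt0 ?subr_gt0 ?g'm // ltrDl.
move=> y x xy; have [c cE] := mvt _ _ xy.
by rewrite -subr_lt0 cE nmulr_rlt0 ?subr_gt0 // subr_lt0 g'm // ltrDl.
Qed.

Lemma derive1n_fdiff {R : realType} (d : R) (k : nat) (f : R -> R) :
  (forall i x, (i < k)%N -> derivable (derive1n i f) x 1) ->
  derive1n k (fdiff d f) = fdiff d (derive1n k f).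
Proof.
elim: k => [//|k IH] df; rewrite !derive1nS IH; last first.
  by move=> i x ik; apply: df; rewrite ltnW.
apply/funext => x; rewrite derive1E; apply: derive_val.
by apply: is_derive_fdiff => y; apply: df.
Qed.

(** Differencing commutes with differentiation, so the [i]-th derivative of [fdiff d f] gets its
    monotonicity from the derivative of [f] of order [i + 1]: each difference costs one order. *)
Lemma kconvex_discrete {R : realType} (k : nat) (f : R -> R) :
  kconvex k f -> discrete_kconvex k f.
Proof.
move=> [[df _] fm]; elim: k f df fm => [|k IH] f df fm.
  by split=> //; exact: (fm 0).
split; first exact: (fm 0).
move=> d d0; apply: IH => [i x ik|i ik]; rewrite derive1n_fdiff.
- have dk : forall y, derivable (derive1n i f) y 1.
    by move=> y; apply: df; rewrite ltnS ltnW.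
  by have := is_derive_fdiff d _ x dk; case.
- by move=> j y ji; apply: df; lia.
- apply: fdiff_monotone => // [y|]; first by apply: df.
  by rewrite -derive1nS; apply: fm.
- by move=> j y ji; apply: df; lia.
Qed.

(** * Iterated sums and differences *)

(* [sd X m n z] says that z belongs to mX - nX. *)
Inductive sd {R : realType} (X : R -> Prop) : nat -> nat -> R -> Prop :=
| sd0 : sd X 0 0 0
| sdD m n x z : X x -> sd X m n z -> sd X m.+1 n (z + x)
| sdB m n x z : X x -> sd X m n z -> sd X m n.+1 (z - x).

Lemma sd_opp {R : realType} (X Y : R -> Prop) m n z :
  (forall x, X x -> Y (- x)) -> sd X m n z -> sd Y m n (- z).
Proof.
move=> XY; elim=> [|{}m {}n x {}z /XY Yx _ h|{}m {}n x {}z /XY Yx _ h].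
- by rewrite oppr0; exact: sd0.
- by rewrite opprD; exact: sdD.
- by rewrite opprD; exact: sdB.
Qed.

Lemma sd_inhabited {R : realType} (X : R -> Prop) m n x :
  X x -> exists z, sd X m n z.
Proof.
move=> Xx; elim: m => [|m [z Sz]]; last by exists (z + x); exact: sdD.
elim: n => [|n [z Sz]]; first by exists 0; exact: sd0.
by exists (z - x); exact: sdB.
Qed.

Lemma sd_sub {R : realType} (X Y : R -> Prop) m n z :
  (forall x, X x -> Y x) -> sd X m n z -> sd Y m n z.
Proof.
move=> XY; elim=> [|{}m {}n x {}z /XY Yx _ h|{}m {}n x {}z /XY Yx _ h].
- exact: sd0.
- exact: sdD.
- exact: sdB.
Qed.

(** An added or subtracted [y - y'] puts one element of [Y] on each side, hence [m + n] on both. *)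
Lemma sd_diff {R : realType} (X Y : R -> Prop) m n z :
  (forall x, X x -> exists y y', [/\ Y y, Y y' & x = y - y']) ->
  sd X m n z -> sd Y (m + n) (m + n) z.
Proof.
move=> XY; elim=> [|{}m {}n x {}z /XY[y [y' [Yy Yy' ->]]] _ h
  |{}m {}n x {}z /XY[y [y' [Yy Yy' ->]]] _ h].
- exact: sd0.
- by rewrite addSn addrA; apply: sdB => //; exact: sdD.
- by rewrite addnS opprB addrA; apply: sdB => //; exact: sdD.
Qed.

(** Start from [u] copies of [x] minus [v] copies of [y]. Turning an added [x] into [y], or a
    subtracted [y] into [x], raises the sum by [y - x], and there are [u + v] such swaps. *)
Lemma sd_progression {R : realType} (X : R -> Prop) (x y : R) u v m :
  X x -> X y -> (m <= u + v)%N ->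
  sd X u v (x *+ u - y *+ v + (y - x) *+ m).
Proof.
move=> Xx Xy; elim: u m => [|u IHu] m.
  elim: v m => [|v IHv] m mv.
    have -> : m = 0%N by lia.
    by rewrite !mulr0n subr0 addr0; exact: sd0.
  case: m mv => [|m] mv.
    have := sdB _ _ _ _ _ Xy (IHv 0%N (leq0n _)); congr sd; rewrite !mulrS !mulr0n; ring.
  have := sdB _ _ _ _ _ Xx (IHv m mv); congr sd; rewrite !mulrS !mulr0n; ring.
case: m => [|m] mv.
  have := sdD _ _ _ _ _ Xx (IHu 0%N (leq0n _)); congr sd; rewrite !mulrS !mulr0n; ring.
have := sdD _ _ _ _ _ Xy (IHu m mv); congr sd; rewrite !mulrS; ring.
Qed.

(** The summands are collected as sequences on [nat], easily extended by one term, and packed into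
    finite functions only at the end. *)
Lemma sd_sumdiff {R : realType} (X : {fset R}) m n z :
  sd (fun x => x \in X) m n z -> z \in sumdiff m n X.
Proof.
move=> h.
have [x [y [xX yX ->]]] : exists x y : nat -> R,
    [/\ forall i, (i < m)%N -> x i \in X, forall i, (i < n)%N -> y i \in X &
      z = \sum_(i < m) x i - \sum_(j < n) y j].
  have ext (w : nat -> R) (l : nat) (x0 : R) :
      \sum_(i < l) (if i == l :> nat then x0 else w i) = \sum_(i < l) w i.
    by apply: eq_bigr => i _; rewrite ltn_eqF.
  elim: h => [|{}m {}n x0 {}z x0X _ [x [y [xX yX ->]]]
    |{}m {}n x0 {}z x0X _ [x [y [xX yX ->]]]].
  - by exists (fun=> 0), (fun=> 0); split=> //; rewrite !big_ord0 subr0.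
  - exists (fun i => if i == m then x0 else x i), y; split=> //.
      by move=> i im; case: eqP => // /eqP ?; apply: xX; lia.
    by rewrite big_ord_recr /= eqxx ext addrAC.
  - exists x, (fun i => if i == n then x0 else y i); split=> //.
      by move=> i im; case: eqP => // /eqP ?; apply: yX; lia.
    by rewrite big_ord_recr /= eqxx ext opprD addrA.
apply/imfset2P.
exists [ffun i : 'I_m => FSetSub (xX i (ltn_ord i))] => //.
exists [ffun i : 'I_n => FSetSub (yX i (ltn_ord i))] => //.
by congr (_ - _); apply: eq_bigr => i _; rewrite ffunE.
Qed.

(** * Disjoint intervals and binomial bounds *)

Lemma glue_intervals {R : realType} (P : R -> Prop) (b : nat -> R)
    (w : nat -> nat) n :
  (forall i, (i < n)%N -> b i <= b i.+1) ->
  (forall i, (i < n)%N -> exists s : seq R, [/\ uniq s, (w i <= size s)%N &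
     forall z, z \in s -> P z /\ b i < z <= b i.+1]) ->
  exists s : seq R, [/\ uniq s, (\sum_(i < n) w i <= size s)%N &
     forall z, z \in s -> P z /\ b 0 < z <= b n].
Proof.
elim: n => [|n IH] bm h; first by exists [::]; rewrite big_ord0.
have [||s [us ws Ps]] := IH; [by move=> i ?; apply: bm; lia
  | by move=> i ?; apply: h; lia | ].
have [s' [us' ws' Ps']] := h n (ltnSn n).
have b0n : b 0 <= b n.
  elim: {IH h s us ws Ps s' us' ws' Ps'} n bm => // n IH bm.
  by apply: le_trans (IH _) (bm _ _) => // i ?; apply: bm; lia.
exists (s ++ s'); split.
- rewrite cat_uniq us us' andbT; apply/hasPn => z /Ps'[_ /andP[bz _]].
  by apply/negP => /Ps[_ /andP[_ zb]]; move: (lt_le_trans bz zb); rewrite ltxx.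
- by rewrite size_cat big_ord_recr /= leq_add.
move=> z; rewrite mem_cat => /orP[/Ps[Pz /andP[z1 z2]]|/Ps'[Pz /andP[z1 z2]]].
  by split=> //; rewrite z1 (le_trans z2) // bm.
by split=> //; rewrite z2 andbT (le_lt_trans _ z1).
Qed.

Lemma sum_bin_diag n k : (\sum_(i < n) 'C(i.+1, k.+1) = 'C(n.+1, k.+2))%N.
Proof.
elim: n => [|n IH]; first by rewrite big_ord0 bin_small.
by rewrite big_ord_recr /= IH [RHS]binS.
Qed.

(** The falling factorial is at least [(n - m + 1) ^ m], and [n <= m * (n - m + 1)] since the
    difference is [(m - 1) * (n - m)]. *)
Lemma expn_le_bin n m :
  (0 < m)%N -> (m <= n)%N -> (n ^ m <= m ^ m * m`! * 'C(n, m))%N.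
Proof.
move=> m0 mn; rewrite -mulnA [(m`! * _)%N]mulnC bin_ffact.
have low l : (l <= m)%N -> ((n - m).+1 ^ l <= n ^_ l)%N.
  elim: l => // l IH lm; rewrite expnSr ffactnSr leq_mul ?IH //; lia.
apply: leq_trans (leq_mul (leqnn _) (low m (leqnn m))).
rewrite -expnMn leq_exp2r //; nia.
Qed.

(** * Squeezing by induction on the order *)

Section Squeezing.
Context {R : realType} (a : nat -> R) (d : R) (N : nat).
Hypothesis d0 : 0 < d.
Hypothesis gap : forall i, (i.+1 < N)%N -> a i + d <= a i.+1.

(** The bound on [m] follows the order: a value of [fdiff d f] with multiple [m] is a difference of
    values of [f] with multiples [m.+1] and [m]. *)
Definition shifted_image (k : nat) (f : R -> R) (z : R) : Prop :=
  exists i m, [/\ (i < N)%N, (m <= k)%N & z = f (a i + d *+ m)].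

(* The hull condition is what makes the induction go through: it confines the
   elements built from the finite difference to a single gap. *)
Lemma squeeze (k : nat) (f : R -> R) (p n : nat) :
  discrete_kconvex k f -> (p + n < N)%N ->
  exists s : seq R, [/\ uniq s, ('C(n.+1, k.+1) <= size s)%N &
    forall z, z \in s -> sd (shifted_image k f) (2 ^ k) (2 ^ k - 1) z /\
      Num.min (f (a p)) (f (a (p + n))) <= z
        <= Num.max (f (a p)) (f (a (p + n)))].
Proof.
have a_mono i j : (i < j < N)%N -> a i < a j.
  elim: j => [|j IH] /andP[ij jN]; first by lia.
  have aj : a j < a j.+1 by apply: lt_le_trans (gap _ jN); rewrite ltrDl.
  by case: (ltngtP i j) => [ij'|//|->//]; [apply: lt_trans aj; apply: IH; lia | lia].
have a_le i j : (i <= j < N)%N -> a i <= a j.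
  by rewrite leq_eqVlt andb_orl => /orP[/andP[/eqP->//]|/a_mono/ltW].
elim: k f p n => [|k IH] f p n.
  case=> fm _ pnN.
  have f_inj i j : (i < j < N)%N -> f (a i) != f (a j).
    by move=> /a_mono; case: fm => fm /fm; [move/lt_eqF->|move/gt_eqF->].
  exists [seq f (a i) | i <- iota p n.+1]; split.
  - rewrite map_inj_in_uniq ?iota_uniq // => i j.
    rewrite !mem_iota => iN jN e.
    by case: (ltngtP i j) => // ij;
      [have := f_inj i j | have := f_inj j i]; rewrite e eqxx; lia.
  - by rewrite size_map size_iota bin1.
  move=> _ /mapP[i + ->]; rewrite mem_iota => /andP[pi ipn]; split.
    rewrite -[f _]add0r expn0; apply: sdD; last exact: sd0.
    by exists i, 0%N; split; [lia| |rewrite mulr0n addr0].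
  have a1 : a p <= a i by apply: a_le; lia.
  have a2 : a i <= a (p + n)%N by apply: a_le; lia.
  rewrite ge_min le_max; case: fm => [/ltW_homo fm|/ltW_nhomo fm].
    by rewrite (fm _ _ a1) (fm _ _ a2) orbT.
  by rewrite (fm _ _ a1) (fm _ _ a2) orbT.
(* For decreasing [f], pass to [- f]: negating the list keeps the numbers of added and subtracted
   terms and exchanges the hull bounds. *)
wlog f_incr : f / {homo f : x y / x < y}.
  move=> wl fk pnN; case: (discrete_kconvex_monotone _ _ fk) => fm.
    exact: (wl f).
  have [|s [us ss hs]] := wl (fun x => - f x) _ (discrete_kconvexN _ _ fk) pnN.
    by move=> x y /fm; rewrite ltrN2.
  exists (map -%R s); split; first by rewrite map_inj_uniq //; exact: oppr_inj.
    by rewrite size_map.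
  move=> _ /mapP[z /hs[hz bz] ->]; split.
    apply: sd_opp hz => _ [i [m [iN mk ->]]]; exists i, m.
    by split=> //; rewrite opprK.
  move: bz; rewrite -oppr_max -oppr_min => /andP[z1 z2].
  by rewrite lerNr z2 lerNl z1.
case=> _ /(_ d d0) fk pnN.
have f_le x y : x <= y -> f x <= f y by apply: ltW_homo.
have block i q l : (i < n)%N -> (q + l < N)%N ->
    Num.max (fdiff d f (a q)) (fdiff d f (a (q + l))) <= fdiff d f (a (p + i)) ->
    exists s : seq R, [/\ uniq s, ('C(l.+1, k.+1) <= size s)%N &
      forall z, z \in s ->
        sd (shifted_image k.+1 f) (2 ^ k.+1) (2 ^ k.+1 - 1) z /\
        f (a (p + i)) < z <= f (a (p + i.+1))].
  move=> ilt qlN top; have [s [us ss hs]] := IH _ _ _ fk qlN.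
  exists [seq z + f (a (p + i)) | z <- s]; split.
  - by rewrite map_inj_uniq //; exact: addIr.
  - by rewrite size_map.
  move=> _ /mapP[u /hs[hu /andP[u1 u2]] ->]; split.
    (* Splitting the differences gives [2 ^ k.+1 - 1] terms on each side; [f (a (p + i))] is the one
       further added term. *)
    have e : (2 ^ k.+1)%N = (2 ^ k + (2 ^ k - 1)).+1.
      by rewrite expnS; have := expn_gt0 2 k; lia.
    rewrite e subSS subn0; apply: sdD.
      by exists (p + i)%N, 0%N; split; [lia| |rewrite mulr0n addr0].
    apply: (sd_diff _ _ _ _ _ _ hu) => _ [j [m [jN mk ->]]].
    exists (f (a j + d *+ m.+1)), (f (a j + d *+ m)); split.
    - by exists j, m.+1.
    - by exists j, m; split=> //; exact: leqW.
    - by rewrite /fdiff mulrSr addrA.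
  have pos x : 0 < fdiff d f x by rewrite subr_gt0 f_incr // ltrDl.
  apply/andP; split.
    by rewrite ltrDr (lt_le_trans _ u1) // lt_min !pos.
  rewrite addrC -lerBrDl (le_trans u2) // (le_trans top) // lerD2r f_le //.
  by rewrite addnS gap //; lia.
have glue w :
    (forall i, (i < n)%N -> exists q l, [/\ (q + l < N)%N, w i = 'C(l.+1, k.+1) &
      Num.max (fdiff d f (a q)) (fdiff d f (a (q + l)))
        <= fdiff d f (a (p + i))]) ->
    (\sum_(i < n) w i)%N = 'C(n.+1, k.+2) ->
    exists s : seq R, [/\ uniq s, ('C(n.+1, k.+2) <= size s)%N &
      forall z, z \in s ->
        sd (shifted_image k.+1 f) (2 ^ k.+1) (2 ^ k.+1 - 1) z /\
        Num.min (f (a p)) (f (a (p + n))) <= z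
          <= Num.max (f (a p)) (f (a (p + n)))].
  move=> hw sw.
  have [||s [us ss hs]] := glue_intervals (sd (shifted_image k.+1 f) (2 ^ k.+1) (2 ^ k.+1 - 1))
      (fun i => f (a (p + i)%N)) w n.
  - by move=> i ilt; apply/f_le/a_le; lia.
  - by move=> i ilt; have [q [l [qlN -> top]]] := hw i ilt; exact: block top.
  exists s; split=> //; first by rewrite -sw.
  move=> z /hs[hz]; rewrite addn0 => /andP[/ltW z1 z2]; split=> //.
  by rewrite ge_min z1 le_max z2 orbT.
(* The values of the difference used at [a (p + i)] come from the terms up to
   it if the difference increases, and from those after it otherwise. *)
case: (discrete_kconvex_monotone _ _ fk) => [/ltW_homo g_le|/ltW_nhomo g_ge].
  apply: (glue (fun i => 'C(i.+1, k.+1))); last exact: sum_bin_diag.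
  move=> i ilt; exists p, i; split=> //; first by lia.
  by rewrite ge_max lexx andbT; apply/g_le/a_le; lia.
(* The blocks stop at index [p + n - 1], so their sizes [n - i] run through [n, ..., 1] and the
   diagonal sum is read backwards. *)
apply: (glue (fun i => 'C((n - i.+1).+1, k.+1))); last first.
  rewrite -sum_bin_diag [RHS](reindex_inj rev_ord_inj) /=.
  by apply: eq_bigr.
move=> i ilt; exists (p + i)%N, (n - i.+1)%N; split=> //; first by lia.
by rewrite ge_max lexx; apply/g_ge/a_le; lia.
Qed.
End Squeezing.

(** * From the sequence to finite sets *)

Local Open Scope fset_scope.

Lemma card_sumdiff_image {R : realType} (u v : nat) (A : {fset R}) (f : R -> R) :
  discrete_kconvex (u + v) f -> (1 < #|` A|)%N ->
  ('C(#|` A|, (u + v).+1) <=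
   #|` sumdiff (2 ^ (u + v)) (2 ^ (u + v) - 1) (f @` sumdiff u.+1 v A)|)%N.
Proof.
move=> fk A1; set k := addn u v.
pose a i := nth 0 (sort <=%R A) i.
have sA : size (sort <=%R A) = #|` A| by rewrite size_sort.
have aA i : (i < #|` A|)%N -> a i \in A.
  by move=> iN; rewrite -(mem_sort <=%R) mem_nth ?sA.
have a_lt i : (i.+1 < #|` A|)%N -> a i < a i.+1.
  have : sorted <%R (sort <=%R A).
    by rewrite lt_sorted_uniq_le sort_uniq fset_uniq sort_sorted //; exact: le_total.
  by move/(sortedP 0) => h; rewrite -sA; exact: h.
have [M NM] : exists M, #|` A| = M.+2 by exists (#|` A| - 2)%N; lia.
have [j _ jmin] := @arg_minP _ R 'I_M.+1 ord0 xpredT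
  (fun i => a i.+1 - a i) isT.
have jN : (j.+1 < #|` A|)%N by rewrite NM ltnS.
pose x := a j; pose y := a j.+1.
(* Translating [A] by the base point of the progression keeps its gaps, all at least [y - x] by
   minimality. *)
pose b i := (a i + (x *+ u - y *+ v))%R.
have yx0 : 0 < y - x by rewrite subr_gt0; exact: a_lt.
have gap i : (i.+1 < #|` A|)%N -> (b i + (y - x) <= b i.+1)%R.
  rewrite NM ltnS => iM; have := jmin (Ordinal iM) isT.
  by rewrite /b /x /y /=; lra.
have [|s [us ss hs]] := squeeze b (y - x) #|` A| yx0 gap k f 0 M.+1 fk.
  by rewrite NM add0n.
rewrite NM (leq_trans ss) //; apply: uniq_leq_size => // z /hs[hz _].
apply: sd_sumdiff; apply: sd_sub hz => _ [i [m [iN mk ->]]].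
apply/imfsetP; exists (b i + (y - x) *+ m)%R => //=; apply: sd_sumdiff.
rewrite /b -addrA addrC; apply: sdD; first exact: aA.
by apply: sd_progression => //; apply: aA => //; exact: ltnW.
Qed.

(** This serves nonempty [A] with at most [k] elements, where the binomial bound is zero. *)
Lemma card_sumdiff_image_gt0 {R : realType} (p q m n : nat) (A : {fset R}) (f : R -> R) :
  (0 < #|` A|)%N -> (0 < #|` sumdiff p q (f @` sumdiff m n A)|)%N.
Proof.
rewrite !cardfs_gt0 => /fset0Pn[x xA].
have [y /sd_sumdiff yA] := sd_inhabited (fun x => x \in A) m n x xA.
have fy : f y \in f @` sumdiff m n A by apply: in_imfset.
have [z /sd_sumdiff zA] := sd_inhabited (fun x => x \in f @` sumdiff m n A) p q _ fy.
by apply/fset0Pn; exists z.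
Qed.

Theorem theorem1p3 (R : realType) (k : nat) (hk : (1 <= k)%N) :
  exists2 c : R, 0 < c &
    forall (A : {fset R}) (f : R -> R), kconvex k f ->
      (forall s : nat, k = (2 * s)%N ->
         c * #|` A|%:R ^+ (k + 1)
         <= #|` sumdiff (2 ^ k) (2 ^ k - 1) (f @` sumdiff (s + 1) s A)|%:R) /\
      (forall s : nat, k = (2 * s - 1)%N ->
         c * #|` A|%:R ^+ (k + 1)
         <= #|` sumdiff (2 ^ k) (2 ^ k - 1) (f @` sumdiff s s A)|%:R).
Proof.
pose C := (k.+1 ^ k.+1 * k.+1`!)%N.
have C0 : (0 < C)%N by rewrite muln_gt0 expn_gt0 fact_gt0.
exists C%:R^-1; first by rewrite invr_gt0 ltr0n.
move=> A f /kconvex_discrete fk.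
have main u v : k = (u + v)%N -> C%:R^-1 * #|` A|%:R ^+ (k + 1)
    <= #|` sumdiff (2 ^ k) (2 ^ k - 1) (f @` sumdiff u.+1 v A)|%:R :> R.
  move=> kE; rewrite ler_pdivrMl ?ltr0n // addn1 -natrX -natrM ler_nat.
  have [Ak|kA] := leqP #|` A| k.
    have [->|A0] := posnP #|` A|; first by rewrite exp0n.
    apply: (@leq_trans (k.+1 ^ k.+1)); first by rewrite leq_exp2r // leqW.
    by rewrite -mulnA leq_pmulr // muln_gt0 fact_gt0 card_sumdiff_image_gt0.
  apply: leq_trans (expn_le_bin _ _ _ kA) _ => //; rewrite leq_mul2l.
  apply/orP; right; move: fk; rewrite kE => fk.
  by apply: card_sumdiff_image => //; lia.
split=> s ks.
  by rewrite (addn1 s); apply: main; lia.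
(* Truncated subtraction makes [s = 0] give [k = 0], excluded by [hk]; otherwise [u = s - 1] and
   [v = s] for the original [s]. *)
case: s ks => [|s] ks; first by lia.
by apply: main; lia.
Qed.
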